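(* Let $\vec{r}:[0,L]\to E^3$ be a unit speed Frenet curve with Frenet frame $\{\vec T,\vec N,\vec B\}$, curvature $\kappa$ and torsion $\tau$. Let $\vec{P}(s,t)=\vec{r}(s)+u(s,t)\vec{T}(s)+v(s,t)\vec{N}(s)+w(s,t)\vec{B}(s)$, $0\le s\le L$, $0\le t\le T$, be a regular surface with $u,v,w$ smooth, and write the unit surface normal at $t_0\in[0,T]$ as $\vec n(s,t_0)=\varphi_1(s,t_0)\vec T(s)+\varphi_2(s,t_0)\vec N(s)+\varphi_3(s,t_0)\vec B(s)$. Suppose $\vec r$ is a $D$-type curve on $\vec P$ (as the parameter curve $t=t_0$), with $\langle\vec n(s,t_0),\vec W_0(s)\rangle=c$, $c$ a real constant. Then $\vec r$ is a general helix on $\vec P$ if and only if for all $s\in[0,L]$ $$u(s,t_0)=v(s,t_0)=w(s,t_0)=0,$$ $$\varphi_1(s,t_0)=0,\qquad \varphi_2(s,t_0)=\pm\sqrt{1-c^2(1+d^2)},\qquad \varphi_3(s,t_0)=c\sqrt{1+d^2}$$ hold, where $\frac{\tau}{\kappa}(s)=d$ is a real constant.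
   Context: $E^3$ is Euclidean 3-space. A Frenet curve is a regular curve with $\vec r''(s)\neq\vec 0$ for all $s$ ($s$ arc length), so $\kappa(s)>0$. Its Frenet frame is $\vec T=\vec r'$, $\vec N=\vec r''/\|\vec r''\|$, $\vec B=\vec T\times\vec N$, with $\vec T'=\kappa\vec N$, $\vec N'=-\kappa\vec T+\tau\vec B$, $\vec B'=-\tau\vec N$. The unit Darboux vector is $\vec W_0=\frac{\tau}{\sqrt{\kappa^2+\tau^2}}\vec T+\frac{\kappa}{\sqrt{\kappa^2+\tau^2}}\vec B$. A surface $\vec P(s,t)$ is regular if $\frac{\partial \vec P}{\partial s}\times\frac{\partial \vec P}{\partial t}\ne\vec 0$ everywhere; its unit normal is $\vec n=\frac{\partial_s\vec P\times\partial_t\vec P}{\|\partial_s\vec P\times\partial_t\vec P\|}$. The curve $\vec r$ is isoparametric on $\vec P$ (at $t_0$) if $\vec P(s,t_0)=\vec r(s)$ for all $s$. A unit speed isoparametric curve $\vec r$ on $\vec P$ is called a $D$-type curve on $\vec P$ if $\langle\vec n(s,t_0),\vec W_0(s)\rangle$ is constant in $s$. A general helix is understood through the characterization that $\frac{\tau}{\kappa}(s)$ is constant (the tangent makes a constant angle with a fixed direction). The right-hand condition of the equivalence is: $\tau/\kappa$ is identically equal to a real constant $d$ and the displayed equations hold with this $d$. The symbol $\pm$ means that $\varphi_2$ equals the indicated square root up to sign. *)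

(* Defs.v *)
From HB Require Import structures.
From mathcomp Require Import all_boot all_order all_algebra.
From mathcomp Require Import all_classical all_reals all_analysis.
Set Implicit Arguments.
Unset Strict Implicit.
Unset Printing Implicit Defensive.
Import Order.TTheory GRing.Theory Num.Theory numFieldNormedType.Exports.
Local Open Scope classical_set_scope.
Local Open Scope ring_scope.

(* E^3 is 'rV[R]_3.  The library norm `|x| on it is the max norm, so it is used
   only for its topology; lengths and angles come from dotv and enorm. *)
Section Euclidean3.
Variable R : realType.
Implicit Types x y : 'rV[R]_3.

Definition dotv x y : R := (x *m y^T) 0 0.

Definition enorm x : R := Num.sqrt (dotv x x).

(* Indices live in 'I_3, so k + 1 and k + 2 are taken modulo 3. *)
Definition crossv x y : 'rV[R]_3 :=
  \row_k (x 0 (k + 1) * y 0 (k + 2%:R) - x 0 (k + 2%:R) * y 0 (k + 1)).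

End Euclidean3.

(* Differentiation relative to a set A of reals: for A = [a, b] this is the
   usual derivative inside and the one-sided derivative at a and at b. *)
Section DerivativeWithin.
Variables (R : realType) (V : normedModType R).

Definition diff_quot (f : R -> V) (x y : R) : V := (y - x)^-1 *: (f y - f x).

Definition derivable_within (A : set R) (f : R -> V) (x : R) : Prop :=
  cvg (diff_quot f x y @[y --> within A x^']).

Definition derive_within (A : set R) (f : R -> V) (x : R) : V :=
  lim (diff_quot f x y @[y --> within A x^']).

Fixpoint Ck_within (k : nat) (A : set R) (f : R -> V) : Prop :=
  {within A, continuous f} /\
  match k with
  | 0%N => True
  | j.+1 => (forall x, A x -> derivable_within A f x) /\
            Ck_within j A (derive_within A f)
  end.

End DerivativeWithin.

Section TwoVariables.
Variables (R : realType) (V : normedModType R).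

Definition partial_s (L : R) (f : R -> R -> V) (s t : R) : V :=
  derive_within `[0, L] (fun x => f x t) s.

Definition partial_t (T : R) (f : R -> R -> V) (s t : R) : V :=
  derive_within `[0, T] (f s) t.

Fixpoint Ck_rect (k : nat) (L T : R) (f : R -> R -> V) : Prop :=
  {within `[0, L] `*` `[0, T], continuous (fun p : R * R => f p.1 p.2)} /\
  match k with
  | 0%N => True
  | j.+1 =>
    [/\ (forall s t : R, s \in `[0, L] -> t \in `[0, T] ->
           derivable_within `[0, L] (fun x => f x t) s /\
           derivable_within `[0, T] (f s) t),
        Ck_rect j L T (partial_s L f)
      & Ck_rect j L T (partial_t T f)]
  end.

End TwoVariables.

Definition smooth_rect (R : realType) (L T : R) (f : R -> R -> R) : Prop :=
  forall k, @Ck_rect R R^o k L T f.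

(* The apparatus of a unit speed curve r parametrized by [0, L]; only the
   values at parameters in [0, L] are meaningful. *)
Section Curves.
Variables (R : realType) (L : R) (r : R -> 'rV[R]_3).

Definition Tvec : R -> 'rV[R]_3 := derive_within `[0, L] r.

Definition acceleration : R -> 'rV[R]_3 := derive_within `[0, L] Tvec.

Definition curvature (s : R) : R := enorm (acceleration s).

Definition Nvec (s : R) : 'rV[R]_3 :=
  (enorm (acceleration s))^-1 *: acceleration s.

Definition Bvec (s : R) : 'rV[R]_3 := crossv (Tvec s) (Nvec s).

(* The coefficient of B in N' = - kappa T + tau B. *)
Definition torsion (s : R) : R :=
  dotv (derive_within `[0, L] Nvec s) (Bvec s).

Definition unit_speed : Prop :=
  forall s : R, s \in `[0, L] -> enorm (Tvec s) = 1.

(* C^3 is the regularity needed for the torsion and the Frenet formulas. *)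
Definition unit_speed_Frenet_curve : Prop :=
  [/\ Ck_within 3 `[0, L] r, unit_speed
    & forall s : R, s \in `[0, L] -> acceleration s != 0].

Definition Darboux_unit (s : R) : 'rV[R]_3 :=
  let kappa := curvature s in let tau := torsion s in
  (tau / Num.sqrt (kappa ^+ 2 + tau ^+ 2)) *: Tvec s +
  (kappa / Num.sqrt (kappa ^+ 2 + tau ^+ 2)) *: Bvec s.

Definition general_helix : Prop :=
  exists d : R, forall s : R, s \in `[0, L] -> torsion s / curvature s = d.

Definition frame_surface (u v w : R -> R -> R) (s t : R) : 'rV[R]_3 :=
  r s + u s t *: Tvec s + v s t *: Nvec s + w s t *: Bvec s.

End Curves.

Section Surfaces.
Variables (R : realType) (L T : R) (P : R -> R -> 'rV[R]_3).

Definition normal_field (s t : R) : 'rV[R]_3 :=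
  crossv (partial_s L P s t) (partial_t T P s t).

Definition regular_surface : Prop :=
  forall s t : R, s \in `[0, L] -> t \in `[0, T] -> normal_field s t != 0.

Definition unit_normal (s t : R) : 'rV[R]_3 :=
  (enorm (normal_field s t))^-1 *: normal_field s t.

Definition isoparametric (r : R -> 'rV[R]_3) (t0 : R) : Prop :=
  forall s : R, s \in `[0, L] -> P s t0 = r s.

Definition D_type_curve (r : R -> 'rV[R]_3) (t0 : R) : Prop :=
  [/\ unit_speed L r, isoparametric r t0
    & exists c : R, forall s : R, s \in `[0, L] ->
        dotv (unit_normal s t0) (Darboux_unit L r s) = c].

End Surfaces.

(* Main.v *)
Require Import Defs.
From HB Require Import structures.
From mathcomp Require Import all_boot all_order all_algebra.
From mathcomp Require Import all_classical all_reals all_analysis.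
From mathcomp Require Import ring lra.
Import Order.TTheory GRing.Theory Num.Theory numFieldNormedType.Exports.
Local Open Scope classical_set_scope.
Local Open Scope ring_scope.

(** A surface that carries r as its parameter curve t = t0 satisfies
    P(s, t0) = r(s), so the vector u T + v N + w B vanishes along t0, and u, v,
    w vanish with it because the Frenet frame is orthonormal.  For the same
    reason the s-derivative of P along t0 is T, and the surface normal, being a
    cross product with that derivative, is orthogonal to T: phi1 = 0
    ([unit_normal_orthogonal_tangent]).

    What is left of the unit normal is phi2 N + phi3 B, with
    phi2^2 + phi3^2 = 1.  Pairing it with the unit Darboux vector gives
    phi3 kappa / sqrt (kappa^2 + tau^2) = c.  When tau = d kappa with
    kappa > 0, the quotient is 1 / sqrt (1 + d^2), which is a constant; this
    determines phi3, and then phi2 up to sign ([phi_of_D_type]).  So a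
    D-type curve that is a general helix satisfies all the displayed equations;
    the converse holds because the equations come with the constancy of
    tau / kappa.

    The only analytic input is that the Frenet frame is orthonormal: T has
    constant length, so its derivative is orthogonal to it
    ([derive_within_orthogonal]). *)

(** * Euclidean geometry of row vectors *)
Section DotCross.
Context {R : realType}.
Implicit Types (x y z : 'rV[R]_3) (a : R).

Lemma sum_ord3 (F : 'I_3 -> R) : \sum_i F i = F 0 + F 1 + F 2%:R.
Proof.
rewrite !big_ord_recl big_ord0 addr0 addrA.
by congr (_ + F _ + F _); apply: val_inj.
Qed.

Lemma dotvE x y :
  dotv x y = x 0 0 * y 0 0 + x 0 1 * y 0 1 + x 0 2%:R * y 0 2%:R.
Proof. by rewrite /dotv mxE sum_ord3 !mxE. Qed.

Lemma dotvC x y : dotv x y = dotv y x.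
Proof. by rewrite !dotvE; ring. Qed.

Lemma dotvDl x y z : dotv (x + y) z = dotv x z + dotv y z.
Proof. by rewrite !dotvE !mxE; ring. Qed.

Lemma dotvZl a x y : dotv (a *: x) y = a * dotv x y.
Proof. by rewrite !dotvE !mxE; ring. Qed.

Lemma dotvDr x y z : dotv x (y + z) = dotv x y + dotv x z.
Proof. by rewrite dotvC dotvDl !(dotvC x). Qed.

Lemma dotvZr a x y : dotv x (a *: y) = a * dotv x y.
Proof. by rewrite dotvC dotvZl (dotvC x). Qed.

Lemma dotvBD x y : dotv (x - y) (x + y) = dotv x x - dotv y y.
Proof. by rewrite !dotvE !mxE; ring. Qed.

Lemma dotv_ge0 x : 0 <= dotv x x.
Proof. by rewrite dotvE -!expr2 !addr_ge0 ?sqr_ge0. Qed.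

Lemma enorm_sqr x : enorm x ^+ 2 = dotv x x.
Proof. by rewrite sqr_sqrtr ?dotv_ge0. Qed.

Lemma enorm_gt0 x : x != 0 -> 0 < enorm x.
Proof.
move=> x0; rewrite sqrtr_gt0 lt_neqAle dotv_ge0 andbT eq_sym.
apply: contra x0; rewrite dotvE -!expr2 !paddr_eq0 ?addr_ge0 ?sqr_ge0 //.
rewrite !sqrf_eq0 => /andP[/andP[/eqP x0 /eqP x1] /eqP x2].
apply/eqP/rowP => i; rewrite mxE.
by case: i => -[|[|[|//]]] Hi; [rewrite -[RHS]x0|rewrite -[RHS]x1|
  rewrite -[RHS]x2]; congr (x _ _); apply: val_inj.
Qed.

Lemma dotv_normalize x : x != 0 ->
  dotv ((enorm x)^-1 *: x) ((enorm x)^-1 *: x) = 1.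
Proof.
move=> /enorm_gt0 x0; rewrite dotvZl dotvZr -enorm_sqr.
by field; rewrite gt_eqF.
Qed.

Lemma crossvE x y :
  (crossv x y 0 0 = x 0 1 * y 0 2%:R - x 0 2%:R * y 0 1) *
  (crossv x y 0 1 = x 0 2%:R * y 0 0 - x 0 0 * y 0 2%:R) *
  (crossv x y 0 2%:R = x 0 0 * y 0 1 - x 0 1 * y 0 0).
Proof.
by do 2?split; rewrite mxE; congr (x _ _ * y _ _ - x _ _ * y _ _);
  apply: val_inj.
Qed.

Lemma dotv_crossl x y : dotv (crossv x y) x = 0.
Proof. by rewrite dotvE !crossvE; ring. Qed.

Lemma dotv_crossr x y : dotv (crossv x y) y = 0.
Proof. by rewrite dotvE !crossvE; ring. Qed.

(** Lagrange's identity, which makes the cross product of two orthonormal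
    vectors a unit vector. *)
Lemma dotv_cross_cross x y :
  dotv (crossv x y) (crossv x y) = dotv x x * dotv y y - dotv x y ^+ 2.
Proof. by rewrite !dotvE !crossvE; ring. Qed.

(** The hypotheses make x, y and their cross product an orthonormal basis; every
    computation with Frenet coordinates below is an instance of this formula. *)
Lemma dotv_frame x y (a1 a2 a3 b1 b2 b3 : R) :
  dotv x x = 1 -> dotv y y = 1 -> dotv x y = 0 ->
  dotv (a1 *: x + a2 *: y + a3 *: crossv x y)
       (b1 *: x + b2 *: y + b3 *: crossv x y) = a1 * b1 + a2 * b2 + a3 * b3.
Proof.
move=> xx yy xy; rewrite !(dotvDl, dotvDr, dotvZl, dotvZr) dotv_cross_cross.
rewrite (dotvC y x) (dotvC x (crossv x y)) (dotvC y (crossv x y)).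
by rewrite dotv_crossl dotv_crossr xx yy xy; ring.
Qed.

Lemma frame_coord_eq0 x y (a1 a2 a3 : R) :
  dotv x x = 1 -> dotv y y = 1 -> dotv x y = 0 ->
  a1 *: x + a2 *: y + a3 *: crossv x y = 0 -> [/\ a1 = 0, a2 = 0 & a3 = 0].
Proof.
move=> xx yy xy z0; have /= := dotv_frame x y a1 a2 a3 a1 a2 a3 xx yy xy.
rewrite z0 -(scale0r 0) dotvZl mul0r -!expr2 => /esym/eqP.
rewrite !paddr_eq0 ?addr_ge0 ?sqr_ge0 // !sqrf_eq0.
by case/andP => /andP[/eqP -> /eqP ->] /eqP ->.
Qed.

Lemma cvg_dotv {U : Type} {F : set_system U} {FF : Filter F}
    (f g : U -> 'rV[R]_3) x y :
  f z @[z --> F] --> x -> g z @[z --> F] --> y ->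
  dotv (f z) (g z) @[z --> F] --> dotv x y.
Proof.
move=> fx gy.
have coord (h : U -> 'rV[R]_3) z i : h @ F --> z ->
    h t 0 i @[t --> F] --> z 0 i.
  by move=> hz; apply: (continuous_cvg _ (@coord_continuous R 1 3 0 i z) hz).
under eq_cvg do rewrite dotvE.
rewrite dotvE; apply: cvgD; first apply: cvgD.
- by apply: cvgM; apply: coord.
- by apply: cvgM; apply: coord.
- by apply: cvgM; apply: coord.
Qed.

End DotCross.

(** * Derivatives within an interval *)
Section Within.
Context {R : realType}.

(** The deleted neighbourhoods within an interval are proper because an
    interval of positive length has no isolated point; limits along them, hence
    one-sided derivatives at the endpoints, are therefore unique. *)
Lemma within_dnbhs_itv_proper (L x : R) : 0 < L -> x \in `[0, L] ->
  ProperFilter (within `[0, L]%classic x^').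
Proof.
rewrite in_itv /= => L0 /andP[x0 xL]; apply: Build_ProperFilter_ex => B.
rewrite /within /= => /nbhs_ballP[e /= e0 Be].
(* The step is at most L / 2, so one of x + m, x - m stays in [0, L]. *)
pose m := Num.min (e / 2) (L / 2).
have [m0 me mL] : [/\ 0 < m, m <= e / 2 & m <= L / 2].
  by rewrite lt_min !divr_gt0 // !ge_min !lexx orbT.
have [xL2|xL2] := leP x (L / 2).
- exists (x + m); apply: Be.
  + by rewrite /ball /= opprD addrA subrr sub0r normrN gtr0_norm //; lra.
  + by rewrite -subr_eq0 addrAC subrr add0r gt_eqF.
  + by rewrite /= in_itv /=; apply/andP; split; lra.
- exists (x - m); apply: Be.
  + by rewrite /ball /= opprB addrC subrK gtr0_norm //; lra.
  + by rewrite -subr_eq0 addrAC subrr add0r oppr_eq0 gt_eqF.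
  + by rewrite /= in_itv /=; apply/andP; split; lra.
Qed.

Context {V : normedModType R}.
Implicit Types (A : set R) (f g : R -> V).

(** Only the values of a function on A matter to its derivative within A, so
    partial derivatives along t = t0 may be computed on r itself. *)
Lemma derive_within_eq A f g (x : R) : ProperFilter (within A x^') -> A x ->
  (forall y, A y -> f y = g y) -> derivable_within A g x ->
  derive_within A f x = derive_within A g x.
Proof.
move=> PF Ax fg dg; apply: cvg_lim => //.
apply: cvg_trans dg; apply: near_eq_cvg.
rewrite near_withinE; near=> y => Ay.
by rewrite /diff_quot !fg.
Unshelve. all: by end_near.
Qed.

End Within.

(** A curve of constant length has <f y - f x, f y + f x> = 0; dividing by
    y - x and letting y tend to x gives <f' x, 2 f x> = 0. *)
Lemma derive_within_orthogonal {R : realType} (A : set R)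
    (f : R -> 'rV[R]_3) (x a : R) : ProperFilter (within A x^') -> A x ->
  {within A, continuous f} -> derivable_within A f x ->
  (forall y, A y -> dotv (f y) (f y) = a) ->
  dotv (derive_within A f x) (f x) = 0.
Proof.
move=> PF Ax cf df fa.
have fx : f y @[y --> within A x^'] --> f x.
  have /subspace_continuousP/(_ x Ax) := cf; apply: cvg_trans => B /=.
  exact: nbhs_dnbhs.
have lim1 := cvg_dotv _ _ _ _ df (cvgD fx (cvg_cst (f x))).
have lim0 : dotv (diff_quot f x y) (f y + f x) @[y --> within A x^'] --> (0 : R).
  apply: cvg_near_cst; rewrite near_withinE; near=> y => Ay.
  by rewrite /diff_quot dotvZl dotvBD !fa // subrr mulr0.
have /eqP : dotv (derive_within A f x) (f x + f x) = 0.
  exact: (cvg_unique (@Rhausdorff R) (lim1 _ _ _) lim0).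
by rewrite dotvDr -mulr2n mulrn_eq0 /= => /eqP.
Unshelve. all: by end_near.
Qed.

(** * The Frenet frame and the surface normal *)
Section FrenetSurface.
Context {R : realType} (L : R) (r : R -> 'rV[R]_3).
Hypotheses (L_gt0 : 0 < L) (Hr : unit_speed_Frenet_curve L r).

Lemma curvature_gt0 s : s \in `[0, L] -> 0 < curvature L r s.
Proof. by case: Hr => _ _ acc0 sL; apply/enorm_gt0/acc0. Qed.

Lemma Tvec_unit s : s \in `[0, L] -> dotv (Tvec L r s) (Tvec L r s) = 1.
Proof. by case: Hr => _ us _ sL; rewrite -enorm_sqr us // expr1n. Qed.

Lemma Nvec_unit s : s \in `[0, L] -> dotv (Nvec L r s) (Nvec L r s) = 1.
Proof. by case: Hr => _ _ acc0 sL; apply/dotv_normalize/acc0. Qed.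

Lemma Tvec_Nvec_orthogonal s : s \in `[0, L] ->
  dotv (Tvec L r s) (Nvec L r s) = 0.
Proof.
case: (Hr) => -[_ [_ [cT [dT _]]]] _ _ sL.
have PF := within_dnbhs_itv_proper L s L_gt0 sL.
have TT' := derive_within_orthogonal _ _ s 1 PF sL cT (dT s sL) Tvec_unit.
by rewrite dotvC dotvZl TT' mulr0.
Qed.

Lemma frame_surface_isoparametric u v w (t0 s : R) : s \in `[0, L] ->
  isoparametric L (frame_surface L r u v w) r t0 ->
  [/\ u s t0 = 0, v s t0 = 0 & w s t0 = 0].
Proof.
move=> sL /(_ s sL); rewrite /frame_surface -!addrA -[RHS]addr0 => /addrI.
rewrite addrA; apply: frame_coord_eq0.
- exact: Tvec_unit.
- exact: Nvec_unit.
- exact: Tvec_Nvec_orthogonal.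
Qed.

Lemma partial_s_isoparametric (P : R -> R -> 'rV[R]_3) (t0 s : R) :
  s \in `[0, L] -> isoparametric L P r t0 -> partial_s L P s t0 = Tvec L r s.
Proof.
case: (Hr) => -[_ [dr _]] _ _ sL Pr; apply: derive_within_eq => //.
- exact: within_dnbhs_itv_proper.
- exact: dr.
Qed.

Lemma unit_normal_orthogonal_tangent (T : R) (P : R -> R -> 'rV[R]_3)
    (t0 s : R) : s \in `[0, L] -> isoparametric L P r t0 ->
  dotv (unit_normal L T P s t0) (Tvec L r s) = 0.
Proof.
move=> sL Pr; rewrite dotvZl /normal_field.
by rewrite (partial_s_isoparametric P t0 s sL Pr) dotv_crossl mulr0.
Qed.

End FrenetSurface.

(** With t = d k and k > 0, sqrt (k^2 + t^2) = k sqrt (1 + d^2), so the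
    Darboux pairing equals p3 / sqrt (1 + d^2). *)
Lemma phi_of_D_type {R : realType} (k t d c p2 p3 : R) :
  0 < k -> t / k = d -> p2 ^+ 2 + p3 ^+ 2 = 1 ->
  p3 * (k / Num.sqrt (k ^+ 2 + t ^+ 2)) = c ->
  (p2 = Num.sqrt (1 - c ^+ 2 * (1 + d ^+ 2)) \/
   p2 = - Num.sqrt (1 - c ^+ 2 * (1 + d ^+ 2))) /\
  p3 = c * Num.sqrt (1 + d ^+ 2).
Proof.
move=> k0 tk p1 pc.
have d1 : 0 < 1 + d ^+ 2 by rewrite ltr_pwDl ?sqr_ge0.
have q0 : Num.sqrt (1 + d ^+ 2) != 0 by rewrite gt_eqF // sqrtr_gt0.
have kt : Num.sqrt (k ^+ 2 + t ^+ 2) = k * Num.sqrt (1 + d ^+ 2).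
  rewrite -[in RHS](gtr0_norm k0) -sqrtr_sqr -sqrtrM ?sqr_ge0 //.
  by congr Num.sqrt; rewrite -tk; field; rewrite gt_eqF.
have p3E : p3 = c * Num.sqrt (1 + d ^+ 2).
  by rewrite -pc kt; field; rewrite q0 gt_eqF.
split=> //.
have <- : p2 ^+ 2 = 1 - c ^+ 2 * (1 + d ^+ 2).
  by move/(canRL (addrK _)): p1; rewrite p3E exprMn sqr_sqrtr ?ltW.
by rewrite sqrtr_sqr; have [_|_] := ger0P p2; [left|right; rewrite opprK].
Qed.

Theorem corollary3p4 (R : realType) (L T : R) (L_gt0 : 0 < L) (T_gt0 : 0 < T)
    (r : R -> 'rV[R]_3) (Hr : unit_speed_Frenet_curve L r)
    (u v w : R -> R -> R)
    (Hu : smooth_rect L T u) (Hv : smooth_rect L T v) (Hw : smooth_rect L T w)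
    (HP : regular_surface L T (frame_surface L r u v w))
    (t0 : R) (Ht0 : t0 \in `[0, T])
    (phi1 phi2 phi3 : R -> R -> R)
    (Hphi : forall s : R, s \in `[0, L] ->
       unit_normal L T (frame_surface L r u v w) s t0 =
       phi1 s t0 *: Tvec L r s + phi2 s t0 *: Nvec L r s
       + phi3 s t0 *: Bvec L r s)
    (HD : D_type_curve L T (frame_surface L r u v w) r t0)
    (c : R)
    (Hc : forall s : R, s \in `[0, L] ->
       dotv (unit_normal L T (frame_surface L r u v w) s t0)
            (Darboux_unit L r s) = c) :
  general_helix L r <->
  exists d : R,
    (forall s : R, s \in `[0, L] -> torsion L r s / curvature L r s = d) /\
    (forall s : R, s \in `[0, L] ->
       (u s t0 = 0 /\ v s t0 = 0 /\ w s t0 = 0) /\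
       [/\ phi1 s t0 = 0,
           phi2 s t0 = Num.sqrt (1 - c ^+ 2 * (1 + d ^+ 2)) \/
           phi2 s t0 = - Num.sqrt (1 - c ^+ 2 * (1 + d ^+ 2))
         & phi3 s t0 = c * Num.sqrt (1 + d ^+ 2)]).
Proof.
split=> [[d Hd]|[d [Hd _]]]; exists d => //; split=> // s sL.
case: (HD) => _ Hiso _.
have [u0 v0 w0] := frame_surface_isoparametric L r L_gt0 Hr u v w t0 s sL Hiso.
split=> //.
have T1 := Tvec_unit L r Hr s sL.
have N1 := Nvec_unit L r Hr s sL.
have TN := Tvec_Nvec_orthogonal L r L_gt0 Hr s sL.
have dotF a1 a2 a3 b1 b2 b3 :=
  dotv_frame (Tvec L r s) (Nvec L r s) a1 a2 a3 b1 b2 b3 T1 N1 TN.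
pose k := curvature L r s; pose t := torsion L r s.
have nE := Hphi s sL.
have phi1_0 : phi1 s t0 = 0.
  have := unit_normal_orthogonal_tangent L r L_gt0 Hr T _ t0 s sL Hiso.
  (* T is the frame vector with coordinates (1, 0, 0). *)
  have := dotF (phi1 s t0) (phi2 s t0) (phi3 s t0) 1 0 0.
  rewrite scale1r !scale0r !addr0 -/(Bvec L r s) -nE => ->.
  by rewrite !mulr0 !addr0 mulr1.
have phi_unit : phi2 s t0 ^+ 2 + phi3 s t0 ^+ 2 = 1.
  have := dotv_normalize _ (HP s t0 sL Ht0).
  rewrite -/(unit_normal _ _ _ _ _) nE dotF phi1_0 => <-; ring.
have phic : phi3 s t0 * (k / Num.sqrt (k ^+ 2 + t ^+ 2)) = c.
  rewrite -(Hc s sL) nE /Darboux_unit /= phi1_0 -/k -/t.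
  set a := t / _; set b := k / _.
  (* The Darboux vector has no N-component. *)
  have := dotF 0 (phi2 s t0) (phi3 s t0) a 0 b.
  by rewrite scale0r (scale0r (Nvec _ _ _)) addr0 => ->; ring.
have k0 := curvature_gt0 L r Hr s sL.
by have [] := phi_of_D_type k t d c _ _ k0 (Hd s sL) phi_unit phic.
Qed.
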